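(* Let $P_1$ be the Cantor distribution satisfying $P_1=\frac12P_1\circ S_1^{-1}+\frac12P_1\circ S_2^{-1}$ with $S_1(x)=\frac13x$ and $S_2(x)=\frac13x+\frac13$, let $P_2$ be the discrete distribution with mass $\frac13$ at each point of $D=\{\frac23,\frac56,1\}$, and let $P=\frac12P_1+\frac12P_2$. Put $\beta=\frac{\log2}{\log3}$. Then the quantization dimension of $P$ exists and $D(P)=D(P_1)=\beta$, but the quantization coefficient for $P$ does not exist, i.e. the sequence $\left(n^{2/\beta}V_n(P)\right)_{n\ge1}$ does not converge.
   Context: $P_1$ is the unique Borel probability measure on $\mathbb R$ satisfying the stated self-similarity relation. For a Borel probability measure $Q$ on $\mathbb R$ with finite second moment, the $n$th quantization error is $V_n(Q)=\inf\{\int\min_{a\in\alpha}(x-a)^2\,dQ(x):\alpha\subset\mathbb R,\ 1\le\mathrm{card}(\alpha)\le n\}$. The quantization dimension of $Q$ is $D(Q)=\lim_{n\to\infty}\frac{2\log n}{-\log V_n(Q)}$, when this limit exists. The $s$-dimensional lower and upper quantization coefficients of $Q$ are $\liminf_n n^{2/s}V_n(Q)$ and $\limsup_n n^{2/s}V_n(Q)$; the quantization coefficient exists if, for $s=D(Q)$, these two agree. The number $\beta$ is the Hausdorff dimension of the Cantor set generated by $S_1,S_2$. *)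

(* Defs.v *)
From HB Require Import structures.
From mathcomp Require Import all_boot all_order all_algebra finmap.
From mathcomp Require Import all_classical all_reals all_analysis.

Set Implicit Arguments.
Unset Strict Implicit.
Unset Printing Implicit Defensive.

Import Order.TTheory GRing.Theory Num.Theory.
Import numFieldNormedType.Exports.

Local Open Scope classical_set_scope.
Local Open Scope ring_scope.

Section quantization.
Context {R : realType}.
Implicit Types (Q : probability (measurableTypeR R) R) (s : R) (n : nat).

(* The neutral element +oo plays no role here when alpha is nonempty. *)
Definition sqdist_to (alpha : {fset R}) (x : R) : \bar R :=
  \big[Order.min/+oo%E]_(a <- alpha) ((x - a) ^+ 2)%:E.

Definition quantization_error Q n : \bar R :=
  ereal_inf [set (\int[Q]_x sqdist_to alpha x)%E
            | alpha in [set alpha : {fset R} | (1 <= #|` alpha| <= n)%N]].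

(* When Q has a finite second moment, quantization_error Q n is finite for all
   n >= 1, so that fine loses nothing. *)
Definition Vn Q n : R := fine (quantization_error Q n).

Definition dimension_seq Q : R^nat := fun n => 2 * ln n%:R / - ln (Vn Q n).

Definition has_quantization_dimension Q : Prop := cvgn (dimension_seq Q).

Definition quantization_dimension Q : R := limn (dimension_seq Q).

Definition coefficient_seq s Q : R^nat := fun n => n%:R `^ (2 / s) * Vn Q n.

Definition lower_quantization_coefficient s Q : \bar R :=
  limn_einf (EFin \o coefficient_seq s Q).

Definition upper_quantization_coefficient s Q : \bar R :=
  limn_esup (EFin \o coefficient_seq s Q).

Definition has_quantization_coefficient Q : Prop :=
  let s := quantization_dimension Q in
  lower_quantization_coefficient s Q = upper_quantization_coefficient s Q.

End quantization.

Section distributions.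
Context {R : realType}.

Definition S1 (x : R) : R := 3^-1 * x.
Definition S2 (x : R) : R := 3^-1 * x + 3^-1.

(* P o S^-1 is the pushforward A |-> P (S @^-1` A); these equations have exactly
   one solution among the Borel probability measures. *)
Definition cantor_distribution (P1 : probability (measurableTypeR R) R) : Prop :=
  forall A : set (measurableTypeR R), measurable A ->
    P1 A = ((2^-1)%R%:E * pushforward P1 S1 A + (2^-1)%R%:E * pushforward P1 S2 A)%E.

Section half_mixture.
Variables Q1 Q2 : probability (measurableTypeR R) R.
Local Open Scope ereal_scope.

Definition half_mixture (A : set (measurableTypeR R)) : \bar R :=
  (2^-1)%R%:E * Q1 A + (2^-1)%R%:E * Q2 A.

Let half_mixtureE : half_mixture =
  measure_add (mscale ((2^-1 : R)%:nng)%R Q1) (mscale ((2^-1 : R)%:nng)%R Q2).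
Proof. by apply/funext => A; rewrite measure_addE. Qed.

Let half_mixture0 : half_mixture set0 = 0.
Proof. rewrite half_mixtureE; exact: (measure0 (measure_add _ _)). Qed.

Let half_mixture_ge0 A : 0 <= half_mixture A.
Proof. rewrite half_mixtureE; exact: (measure_ge0 (measure_add _ _)). Qed.

Let half_mixture_sigma_additive : semi_sigma_additive half_mixture.
Proof. rewrite half_mixtureE; exact: (@measure_semi_sigma_additive _ _ _ (measure_add _ _)). Qed.

HB.instance Definition _ := isMeasure.Build _ _ _ half_mixture
  half_mixture0 half_mixture_ge0 half_mixture_sigma_additive.

Let half_mixture_setT : half_mixture setT = 1.
Proof.
rewrite /half_mixture !probability_setT !mule1 -EFinD; congr (_%:E).
by rewrite [RHS]splitr div1r.
Qed.

HB.instance Definition _ :=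
  Measure_isProbability.Build _ _ _ half_mixture half_mixture_setT.

End half_mixture.

Section uniformD.
Local Open Scope ereal_scope.

Definition uniformD (A : set (measurableTypeR R)) : \bar R :=
  (3^-1)%R%:E * (\d_(2 / 3 : measurableTypeR R)%R A +
               \d_(5 / 6 : measurableTypeR R)%R A +
               \d_(1 : measurableTypeR R)%R A).

Let uniformDE : uniformD =
  mscale ((3^-1 : R)%:nng)%R
    (measure_add (measure_add \d_(2 / 3 : measurableTypeR R)%R
                              \d_(5 / 6 : measurableTypeR R)%R)
                 \d_(1 : measurableTypeR R)%R).
Proof.
apply/funext => A; rewrite /uniformD /mscale; congr (_ * _).
by rewrite [RHS]measure_addE; congr (_ + _); rewrite [RHS]measure_addE.
Qed.

Let uniformD0 : uniformD set0 = 0.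
Proof. rewrite uniformDE; exact: (measure0 (mscale _ _)). Qed.

Let uniformD_ge0 A : 0 <= uniformD A.
Proof. rewrite uniformDE; exact: (measure_ge0 (mscale _ _)). Qed.

Let uniformD_sigma_additive : semi_sigma_additive uniformD.
Proof. rewrite uniformDE; exact: (@measure_semi_sigma_additive _ _ _ (mscale _ _)). Qed.

HB.instance Definition _ := isMeasure.Build _ _ _ uniformD
  uniformD0 uniformD_ge0 uniformD_sigma_additive.

Let uniformD_setT : uniformD setT = 1.
Proof.
rewrite /uniformD !diracT -!EFinD -EFinM; congr (_%:E).
by rewrite -addrA mulVf// pnatr_eq0.
Qed.

HB.instance Definition _ :=
  Measure_isProbability.Build _ _ _ uniformD uniformD_setT.

End uniformD.

End distributions.

(* Main.v *)
Require Import Defs.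
From mathcomp Require Import all_boot all_order all_algebra finmap.
From mathcomp Require Import all_classical all_reals all_analysis.
From mathcomp Require Import measurable_realfun ring lra zify.
Import Order.TTheory GRing.Theory Num.Theory.
Import numFieldNormedType.Exports.
Local Open Scope classical_set_scope.
Local Open Scope ring_scope.

Set Implicit Arguments.
Unset Strict Implicit.

(** Translating the quantizers of [P1] along the two contractions gives
    [V_(2^l)(P1) <= 9^-l V_1(P1) = 9^-l / 32].  Conversely, the [2^l] cells of
    level [l] have diameter [3^-l / 2] and are separated by gaps at least as
    long, so each codebook point is near at most one cell.  A cell without near
    point costs at least [2c], a cell with a single one at least [c], up to the
    factor [18^-l], with [c = 37/2000]; this gives
    [V_n(P1) >= 18^-l c (2 2^l - n)].  Since three extra points make the atoms
    free, [V_n(P1) / 2 <= V_n(P) <= V_(n-3)(P1) / 2].  Both measures thus have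
    dimension [beta]; and [n^(2/beta) V_n(P)] oscillates, being asymptotically
    at most [1/64] along [n = 2^l + 3] and at least [(c/36) 3^(2/beta) > 1/64]
    along [n = 3 2^l]. *)

(** * Squared distance to a finite codebook *)

Section sqdist.
Context {R : realType}.
Implicit Types (alpha : {fset R}) (x : R).

Lemma sqdist_to_ge alpha x (m : R) :
  (forall a, a \in alpha -> m <= (x - a) ^+ 2) -> (m%:E <= sqdist_to alpha x)%E.
Proof.
move=> h; rewrite /sqdist_to big_seq; apply: le_bigmin; first exact: leey.
by move=> a aa; rewrite lee_fin h.
Qed.

Lemma sqdist_to_ge0 alpha x : (0 <= sqdist_to alpha x)%E.
Proof. by apply: sqdist_to_ge => a _; exact: sqr_ge0. Qed.

Lemma sqdist_to_le alpha x a :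
  a \in alpha -> (sqdist_to alpha x <= ((x - a) ^+ 2)%:E)%E.
Proof.
rewrite /sqdist_to => aa; have {aa} : a \in enum_fset alpha by [].
elim: (enum_fset alpha) => // b s ih.
rewrite inE big_cons ge_min => /predU1P[->|/ih ->]; first by rewrite lexx.
by rewrite orbT.
Qed.

Lemma sqdist_to_subset alpha beta x :
  {subset alpha <= beta} -> (sqdist_to beta x <= sqdist_to alpha x)%E.
Proof.
move=> h; rewrite {2}/sqdist_to big_seq; apply: le_bigmin; first exact: leey.
by move=> a /h; exact: sqdist_to_le.
Qed.

Lemma measurable_sqdist_to alpha :
  measurable_fun setT (sqdist_to alpha : measurableTypeR R -> \bar R).
Proof.
rewrite /sqdist_to; elim: (enum_fset alpha) => [|a s ih].
  by under eq_fun do rewrite big_nil; exact: measurable_cst.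
under eq_fun do rewrite big_cons; apply: measurable_mine => //.
by apply/measurable_EFinP; apply: measurable_funX; exact: measurable_funB.
Qed.

End sqdist.

(** * Integration against averages of two measures *)

Section cantor.
Context {R : realType}.
Implicit Types (Q : probability (measurableTypeR R) R).

Lemma measurable_S1 :
  measurable_fun setT (S1 : measurableTypeR R -> measurableTypeR R).
Proof. by apply: measurable_funM. Qed.

Lemma measurable_S2 :
  measurable_fun setT (S2 : measurableTypeR R -> measurableTypeR R).
Proof. by apply: measurable_funD => //; exact: measurable_funM. Qed.

Local Open Scope ereal_scope.

(** Shared by the mixture [P] and by [P1] itself, which self-similarity makes the average of its
    pushforwards under [S1] and [S2]. *)
Lemma ge0_integral_average (m m1 m2 : {measure set (measurableTypeR R) -> \bar R})
    (f : measurableTypeR R -> \bar R) :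
  (forall A, measurable A ->
     m A = (2^-1)%R%:E * m1 A + (2^-1)%R%:E * m2 A) ->
  measurable_fun setT f -> (forall x, 0 <= f x) ->
  \int[m]_x f x = (2^-1)%R%:E * (\int[m1]_x f x + \int[m2]_x f x).
Proof.
move=> mE mf f0.
rewrite (@eq_measure_integral _ _ _ _
  (measure_add (mscale ((2^-1 : R)%:nng)%R m1) (mscale ((2^-1 : R)%:nng)%R m2))).
  rewrite ge0_integral_measure_add// !ge0_integral_mscale//=.
  by rewrite [RHS]ge0_muleDr//; apply: integral_ge0 => x _; exact: f0.
move=> A mA _; rewrite mE//; symmetry; exact: measure_addE.
Qed.

Lemma integral_half_mixture Q1 Q2 (f : measurableTypeR R -> \bar R) :
  measurable_fun setT f -> (forall x, 0 <= f x) ->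
  \int[half_mixture Q1 Q2]_x f x =
  (2^-1)%R%:E * (\int[Q1]_x f x + \int[Q2]_x f x).
Proof. by move=> mf f0; apply: ge0_integral_average. Qed.

(** Meant for codebooks that contain the three atoms, where the squared distance vanishes. *)
Lemma integral_uniformD_eq0 (f : measurableTypeR R -> \bar R) :
  measurable_fun setT f -> (forall x, 0 <= f x) ->
  f (2 / 3)%R = 0 -> f (5 / 6)%R = 0 -> f 1%R = 0 ->
  \int[uniformD]_x f x = 0.
Proof.
move=> mf f0 f23 f56 f1.
rewrite (@eq_measure_integral _ _ _ _ (mscale ((3^-1 : R)%:nng)%R
    (measure_add (measure_add \d_(2 / 3 : measurableTypeR R)%R
                              \d_(5 / 6 : measurableTypeR R)%R)
                 \d_(1 : measurableTypeR R)%R))).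
  rewrite ge0_integral_mscale// !ge0_integral_measure_add// !integral_dirac//.
  by rewrite f23 f56 f1 !mule0 !adde0 mule0.
move=> A mA _; rewrite /= /uniformD /mscale; congr (_ * _).
by rewrite [RHS]measure_addE; congr (_ + _); rewrite [RHS]measure_addE.
Qed.

Variables (P1 : probability (measurableTypeR R) R).
Hypothesis hP1 : cantor_distribution P1.

Lemma integral_cantor (f : measurableTypeR R -> \bar R) :
  measurable_fun setT f -> (forall x, 0 <= f x) ->
  \int[P1]_x f x =
  (2^-1)%R%:E * (\int[P1]_x f (S1 x) + \int[P1]_x f (S2 x)).
Proof.
move=> mf f0.
pose m1 : {measure set (measurableTypeR R) -> \bar R} :=
  measure_function_pushforward__canonical__measure_function_Measure P1 measurable_S1.
pose m2 : {measure set (measurableTypeR R) -> \bar R} :=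
  measure_function_pushforward__canonical__measure_function_Measure P1 measurable_S2.
rewrite (@ge0_integral_average P1 m1 m2)//=.
rewrite !ge0_integral_pushforward//=; [exact: measurable_S2|exact: measurable_S1].
Qed.

End cantor.

(** * Support and variance of the Cantor distribution *)

Section cantor_support.
Context {R : realType} (P1 : probability (measurableTypeR R) R).
Hypothesis hP1 : cantor_distribution P1.

Let outer (t : R) : set (measurableTypeR R) := ~` `[- t, 2^-1 + t].

Let outerP t x : outer t x <-> (x < - t \/ 2^-1 + t < x).
Proof.
rewrite /outer /= in_itv/=; split=> [/negP|h].
  by rewrite negb_and -!ltNge => /orP.
by apply/negP; rewrite negb_and -!ltNge; apply/orP.
Qed.

Let measurable_outer t : measurable (outer t).
Proof. exact: measurableC. Qed.

Let outer_sub s t : s <= t -> outer t `<=` outer s.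
Proof. by move=> st x /outerP h; apply/outerP; lra. Qed.

(* Both contractions divide the distance to [0, 1/2] by at least 3. *)
Let le_outer3 (t : R) : 0 <= t -> (P1 (outer t) <= P1 (outer (3 * t)))%E.
Proof.
move=> t0; rewrite {1}hP1// -ge0_muleDr; [|exact: (measure_ge0 P1)|exact: (measure_ge0 P1)].
have h S : measurable_fun setT (S : measurableTypeR R -> measurableTypeR R) ->
    (S = S1 \/ S = S2) ->
    (pushforward P1 S (outer t) <= P1 (outer (3 * t)))%E.
  move=> mS SE; rewrite /pushforward; apply: le_measure; rewrite ?inE//.
    by rewrite -[X in measurable X]setTI; exact: mS.
  by case: SE => -> x /outerP; rewrite /S1 /S2 => h; apply/outerP; lra.
apply: (@le_trans _ _ ((2^-1)%:E * (P1 (outer (3 * t)) + P1 (outer (3 * t)))))%E.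
  by apply: lee_wpmul2l => //; apply: leeD; apply: h;
    [exact: measurable_S1|by left|exact: measurable_S2|by right].
rewrite -(fineK (fin_num_measure P1 _ (measurable_outer (3 * t)))).
by rewrite -EFinD -EFinM lee_fin; lra.
Qed.

(** The mass of [outer t] is at most that of [outer (3 ^+ n * t)] for every [n]; these sets decrease
    to the empty set, so continuity from above applies. *)
Let outer_eq0 (t : R) : 0 < t -> P1 (outer t) = 0%E.
Proof.
move=> t0; pose F n := outer (3 ^+ n * t).
have F_ge n : (P1 (outer t) <= P1 (F n))%E.
  elim: n => [|n ih]; first by rewrite /F expr0 mul1r.
  apply: (le_trans ih); rewrite /F exprS -mulrA; apply: le_outer3.
  by rewrite mulr_ge0 ?exprn_ge0 ?ltW.
have F0 : \bigcap_n F n = set0.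
  rewrite -subset0 => x Fx.
  have /= := Fx (Num.truncn (`|x| / t)).+1 I => /outerP.
  set n := (Num.truncn _).+1; have : `|x| < 3 ^+ n * t.
    rewrite -ltr_pdivrMr//; apply: (lt_trans (truncnS_gt _)).
    by rewrite -natrX ltr_nat ltn_expl.
  by rewrite ltr_norml => /andP[? ?]; lra.
apply/eqP; rewrite eq_le measure_ge0 andbT -(measure0 P1) -F0.
have cF : P1 \o F @ \oo --> P1 (\bigcap_n F n).
  apply: nonincreasing_cvg_mu => //.
  - by apply: le_lt_trans (ltry 1); exact: (probability_le1 P1 (measurable_outer _)).
  - by move=> n; exact: measurable_outer.
  - by apply: bigcapT_measurable => n; exact: measurable_outer.
  - move=> n m nm; apply/subsetPset/outer_sub.
    by apply: ler_wpM2r; [exact: ltW|apply: ler_weXn2l => //; rewrite ler1n].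
by apply: (cvge_ge _ cF); apply: nearW => n; exact: F_ge.
Qed.

(** [S1] and [S2] fix 0 and 1/2, the ends of the convex hull of the Cantor set. The complement of
    this hull is the union of the null sets [outer n.+1%:R^-1]. *)
Lemma cantor_ae : {ae P1, forall x : R, 0 <= x <= 2^-1}.
Proof.
have [N [mN N0 sN]] : P1.-negligible (\bigcup_n outer n.+1%:R^-1).
  apply: negligible_bigcup => n; exists (outer n.+1%:R^-1).
  by split; [exact: measurable_outer|apply: outer_eq0; rewrite invr_gt0|].
exists N; split => // x /= /negP; rewrite negb_and -!ltNge => h; apply: sN.
pose y := Num.max (- x) (x - 2^-1).
have y0 : 0 < y by rewrite lt_max; case/orP: h => h; apply/orP; [left|right]; lra.
exists (Num.truncn y^-1) => //; apply/outerP.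
have : (Num.truncn y^-1).+1%:R^-1 < y.
  by rewrite invf_plt ?posrE// truncnS_gt.
by rewrite lt_max; move: _.+1%:R^-1 => e /orP[?|?]; [left|right]; lra.
Qed.

Local Open Scope ereal_scope.

Lemma integral_cantor_ge (f : measurableTypeR R -> \bar R) (m : R) :
  measurable_fun setT f -> (forall x, 0 <= f x) -> (0 <= m)%R ->
  (forall x : R, (0 <= x <= 2^-1)%R -> m%:E <= f x) -> m%:E <= \int[P1]_x f x.
Proof.
move=> mf f0 m0 h.
rewrite -[leLHS]mule1 -(probability_setT P1) -integral_cst//.
apply: ae_ge0_le_integral => //.
case: cantor_ae => N [mN N0 hN]; exists N; split => // x /= hx.
by apply: hN => /= /h h'; apply: hx.
Qed.

Lemma integral_cantor_le (f : measurableTypeR R -> \bar R) (m : R) :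
  measurable_fun setT f -> (forall x, 0 <= f x) -> (0 <= m)%R ->
  (forall x : R, (0 <= x <= 2^-1)%R -> f x <= m%:E) -> \int[P1]_x f x <= m%:E.
Proof.
move=> mf f0 m0 h.
rewrite -[leRHS]mule1 -(probability_setT P1) -integral_cst//.
apply: ae_ge0_le_integral => //.
case: cantor_ae => N [mN N0 hN]; exists N; split => // x /= hx.
by apply: hN => /= /h h'; apply: hx.
Qed.

(* With [y = x - 1/4], [S1] and [S2] become [y / 3 - 1 / 6] and [y / 3 + 1 / 6],
   whence the fixed point equation [I = I / 9 + 1 / 36]. *)
Lemma cantor_variance :
  \int[P1]_x ((x - 4^-1) ^+ 2)%:E = (32^-1)%R%:E.
Proof.
have mf : measurable_fun setT (fun x : measurableTypeR R => ((x - 4^-1) ^+ 2)%:E).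
  apply/measurable_EFinP; apply: measurable_funX.
  exact: measurable_funB.
have f0 (x : R) : 0 <= ((x - 4^-1) ^+ 2)%:E by rewrite lee_fin sqr_ge0.
set I := LHS.
(* Finiteness matters: +oo also solves the fixed point equation. *)
have Ifin : I \is a fin_num.
  rewrite ge0_fin_numE ?integral_ge0//.
  apply: (@le_lt_trans _ _ 1%E) (ltry _).
  by apply: integral_cantor_le => // x hx; rewrite lee_fin; nra.
have mS (S : R -> R) : measurable_fun setT (S : measurableTypeR R -> measurableTypeR R) ->
    measurable_fun setT (fun x : measurableTypeR R => ((S x - 4^-1) ^+ 2)%:E).
  by move=> mS; exact: (measurableT_comp mf mS).
(* The cross terms of [(y / 3 - 1 / 6) ^ 2] and [(y / 3 + 1 / 6) ^ 2] cancel, leaving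
   [2 / 9 * y ^ 2 + 1 / 18]. *)
have : I = (2^-1)%R%:E * ((2 / 9)%R%:E * I + (18^-1)%R%:E).
  rewrite {1}/I integral_cantor//; congr (_ * _).
  rewrite -ge0_integralD; last 5 first.
  - exact: measurableT.
  - by move=> x _; exact: f0.
  - exact: (mS _ measurable_S1).
  - by move=> x _; exact: f0.
  - exact: (mS _ measurable_S2).
  rewrite -ge0_integralZl_EFin//.
  rewrite -[X in _ + X]mule1 -(probability_setT P1) -integral_cst//.
  rewrite -ge0_integralD; last 5 first.
  - exact: measurableT.
  - by move=> x _; rewrite mule_ge0.
  - exact: measurable_funeM.
  - by move=> x _; rewrite /= lee_fin.
  - exact: measurable_cst.
  apply: eq_integral => x _; rewrite /= -EFinM -!EFinD /S1 /S2; congr (_%:E).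
  by field.
rewrite -(fineK Ifin) -EFinM => -[h]; congr (_%:E); lra.
Qed.

End cantor_support.

(** * Upper and lower distortion bounds for codebooks of the Cantor distribution *)

Section cantor_quantization.
Context {R : realType} (P1 : probability (measurableTypeR R) R).
Hypothesis hP1 : cantor_distribution P1.
Implicit Types (alpha beta : {fset R}) (t r u x y : R).

Lemma sqdist_to_attained alpha x : (0 < #|` alpha|)%N ->
  exists2 a, a \in alpha & sqdist_to alpha x = ((x - a) ^+ 2)%:E.
Proof.
suff h (s : seq R) : (0 < size s)%N -> exists2 a, a \in s &
    \big[Order.min/+oo%E]_(a <- s) ((x - a) ^+ 2)%:E = ((x - a) ^+ 2)%:E.
  by move=> /h[a aa e]; exists a.
elim: s => // b [_ _|c s /(_ isT)[a ac e] _].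
  by exists b; rewrite ?mem_head// big_seq1.
rewrite big_cons e; case: leP => _; first by exists b; rewrite ?mem_head.
by exists a; rewrite // inE ac orbT.
Qed.

(** Induction on [l], starting from the mean 1/4. The union of the images of a codebook under [S1]
    and [S2] at most doubles its size, and both contractions divide squared distances by 9. *)
Lemma cantor_codebook (l : nat) : exists2 alpha, (1 <= #|` alpha| <= 2 ^ l)%N &
  (\int[P1]_x sqdist_to alpha x <= ((9 ^+ l)^-1 / 32)%:E)%E.
Proof.
elim: l => [|l [alpha /andP[a0 al] ih]].
  exists [fset (4^-1 : R)]%fset; first by rewrite cardfs1.
  rewrite expr0 invr1 mul1r -(cantor_variance hP1).
  apply: ge0_le_integral => //.
  - by move=> x _; exact: sqdist_to_ge0.
  - exact: measurable_sqdist_to.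
  - apply/measurable_EFinP; apply: measurable_funX; exact: measurable_funB.
  - by move=> x _; apply: sqdist_to_le; rewrite inE.
exists ((S1 @` alpha) `|` (S2 @` alpha))%fset.
  apply/andP; split.
    have [a aa _] := sqdist_to_attained 0 a0.
    by rewrite cardfs_gt0; apply/fset0Pn; exists (S1 a); rewrite inE in_imfset.
  rewrite expnS mul2n -addnn.
  rewrite cardfsU (leq_trans (leq_subr _ _))// leq_add//.
  - by rewrite card_imfset// => x y; rewrite /S1; lra.
  - by rewrite card_imfset// => x y; rewrite /S2; lra.
set beta := (_ `|` _)%fset.
have le9 (S : R -> R) x : (S = S1 \/ S = S2) ->
    (sqdist_to beta (S x) <= (9^-1)%:E * sqdist_to alpha x)%E.
  move=> SE; have [a aa ->] := sqdist_to_attained x a0.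
  have Sa : S a \in beta by case: SE => ->; rewrite inE in_imfset ?orbT.
  apply: (le_trans (sqdist_to_le _ Sa)); rewrite -EFinM lee_fin.
  by case: SE => ->; rewrite /S1 /S2; lra.
have mb := @measurable_sqdist_to R beta; have ma := @measurable_sqdist_to R alpha.
have le9int (S : R -> R) : measurable_fun setT (S : measurableTypeR R -> measurableTypeR R) ->
    (S = S1 \/ S = S2) ->
    (\int[P1]_x sqdist_to beta (S x) <= (9^-1)%:E * ((9 ^+ l)^-1 / 32)%:E)%E.
  move=> mS SE; 
  apply: (@le_trans _ _ ((9^-1)%:E * \int[P1]_x sqdist_to alpha x)%E); last first.
    by apply: lee_wpmul2l => //; rewrite lee_fin.
  rewrite -ge0_integralZl_EFin//; last by move=> x _; exact: sqdist_to_ge0.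
  apply: ge0_le_integral => //.
  - by move=> x _; exact: sqdist_to_ge0.
  - exact: (measurableT_comp mb mS).
  - exact: measurable_funeM.
  - by move=> x _; exact: le9.
rewrite integral_cantor//; last by move=> x; exact: sqdist_to_ge0.
apply: (le_trans (lee_wpmul2l _ (leeD (le9int _ measurable_S1 (or_introl erefl))
  (le9int _ measurable_S2 (or_intror erefl))))) => //.
by rewrite lee_fin exprS invfM; lra.
Qed.

Lemma integral_cantor_ge_half (f : measurableTypeR R -> \bar R) (m1 m2 : R) :
  measurable_fun setT f -> (forall x, 0 <= f x)%E ->
  (m1%:E <= \int[P1]_x f (S1 x))%E -> (m2%:E <= \int[P1]_x f (S2 x))%E ->
  (((m1 + m2) / 2)%:E <= \int[P1]_x f x)%E.
Proof.
move=> mf f0 h1 h2; rewrite (integral_cantor hP1)// mulrC EFinM EFinD.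
by rewrite lee_wpmul2l//; exact: leeD.
Qed.

Lemma measurable_sqdist_to_affine alpha t r :
  measurable_fun setT (fun x : measurableTypeR R => sqdist_to alpha (t + r * x)).
Proof.
have mT : measurable_fun setT
    ((fun x => t + r * x) : measurableTypeR R -> measurableTypeR R).
  by apply: measurable_funD => //; exact: measurable_funM.
exact: (measurableT_comp (@measurable_sqdist_to R alpha) mT).
Qed.

(** The cell is [t + r * [0, 1/2]], with [y] and [u] in its own coordinates. The only possible near
    point is [u]; every other codebook point lies outside []-1/4, 3/4[] in these coordinates, and
    the last hypothesis keeps [d] below the distance from [y] to that outside. *)
Lemma sqdist_to_affine_ge alpha t r u y (d : R) : 0 < r ->
  (forall a, a \in alpha ->
    [\/ a = t + r * u, a <= t - r / 4 | t + 3 * r / 4 <= a]) ->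
  0 <= d -> [\/ d = 0, d <= y - u | d <= u - y] -> d - 4^-1 <= y <= 3 / 4 - d ->
  ((r ^+ 2 * d ^+ 2)%:E <= sqdist_to alpha (t + r * y))%E.
Proof.
move=> r0 h d0 dE /andP[dy yd]; apply: sqdist_to_ge => a /h ha.
suff : r * d <= `|t + r * y - a|.
  move=> H; rewrite -exprMn -[leRHS]real_normK ?num_real//.
  by rewrite ler_pXn2r// ?nnegrE// mulr_ge0// ltW.
have rd : r * (d - 4^-1) <= r * y <= r * (3 / 4 - d) by rewrite !ler_pM2l// dy.
rewrite ler_normr; case: ha => [->|ha|ha].
- case: dE => [->|dE|dE].
  + by rewrite mulr0 -ler_normr normr_ge0.
  + have : r * d <= r * (y - u) by rewrite ler_pM2l.
    by move=> H; apply/orP; left; lra.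
  + have : r * d <= r * (u - y) by rewrite ler_pM2l.
    by move=> H; apply/orP; right; lra.
- by apply/orP; left; lra.
- by apply/orP; right; lra.
Qed.

(** A single point cannot be close to both halves of a cell. The cell is cut into its eight subcells
    of level 3, each of mass 1/8, and the distance to each is bounded below by a constant. *)
Lemma cantor_one_near alpha t r u : 0 < r ->
  (forall a, a \in alpha ->
    [\/ a = t + r * u, a <= t - r / 4 | t + 3 * r / 4 <= a]) ->
  ((37 / 2000 * r ^+ 2)%:E <= \int[P1]_x sqdist_to alpha (t + r * x))%E.
Proof.
move=> r0 h.
pose f y := sqdist_to alpha (t + r * y).
have mf : measurable_fun setT (f : measurableTypeR R -> \bar R).
  exact: measurable_sqdist_to_affine.
have f0 y : (0 <= f y)%E by exact: sqdist_to_ge0.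
have mS (g : R -> \bar R) : measurable_fun setT (g : measurableTypeR R -> \bar R) ->
    measurable_fun setT ((g \o S1) : measurableTypeR R -> \bar R) /\
    measurable_fun setT ((g \o S2) : measurableTypeR R -> \bar R).
  move=> mg; split; first exact: (measurableT_comp mg measurable_S1).
  exact: (measurableT_comp mg measurable_S2).
have [m1 m2] := mS _ mf; have [m11 m12] := mS _ m1; have [m21 m22] := mS _ m2.
have [? ?] := mS _ m11; have [? ?] := mS _ m12.
have [? ?] := mS _ m21; have [? ?] := mS _ m22.
(* [d] bounds from below the distance from [u] to [L, L + 1/54], the hull of a
   cell of level 3. *)
pose far (d L : R) := 0 <= d <= 4^-1 /\ [\/ d = 0, d <= L - u | d <= u - L - 54^-1].
have cell d L x : far d L -> 0 <= L <= 26 / 54 -> 0 <= x <= 2^-1 ->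
    ((r ^+ 2 * d ^+ 2)%:E <= f (L + x / 27)%R)%E.
  move=> [d0 dE] L0 x0; apply: (@sqdist_to_affine_ge _ _ _ u) => //; last 1 first.
  - by clear -hP1 d0 L0 x0; lra.
  - by case/andP: d0.
  - by clear -hP1 dE x0; case: dE => dE; [apply: Or31|apply: Or32|apply: Or33]; lra.
(* The numbers 0, 1/27, ..., 13/27 are the left ends of the eight subcells, in increasing order. The
   cap 1/4 in [far] accounts for the codebook points outside. *)
have bound d1 d2 d3 d4 d5 d6 d7 d8 :
    8 * 37 / 2000 <= d1 ^+ 2 + d2 ^+ 2 + d3 ^+ 2 + d4 ^+ 2 +
      d5 ^+ 2 + d6 ^+ 2 + d7 ^+ 2 + d8 ^+ 2 ->
    far d1 0 ->
    far d2 (27^-1) ->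
    far d3 (9^-1) ->
    far d4 (4 / 27) ->
    far d5 (3^-1) ->
    far d6 (10 / 27) ->
    far d7 (4 / 9) ->
    far d8 (13 / 27) ->
    ((37 / 2000 * r ^+ 2)%:E <= \int[P1]_x f x)%E.
  move=> dE e1 e2 e3 e4 e5 e6 e7 e8.
  have h1 x : 0 <= x <= 2^-1 ->
      ((r ^+ 2 * d1 ^+ 2)%:E <= f (S1 (S1 (S1 x))))%E.
    have -> : S1 (S1 (S1 x)) = 0 + x / 27 by rewrite /S1 /S2; lra.
    by move=> x0; apply: (cell _ _ _ e1 _ x0); clear -hP1; lra.
  have h2 x : 0 <= x <= 2^-1 ->
      ((r ^+ 2 * d2 ^+ 2)%:E <= f (S1 (S1 (S2 x))))%E.
    have -> : S1 (S1 (S2 x)) = 27^-1 + x / 27 by rewrite /S1 /S2; lra.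
    by move=> x0; apply: (cell _ _ _ e2 _ x0); clear -hP1; lra.
  have h3 x : 0 <= x <= 2^-1 ->
      ((r ^+ 2 * d3 ^+ 2)%:E <= f (S1 (S2 (S1 x))))%E.
    have -> : S1 (S2 (S1 x)) = 9^-1 + x / 27 by rewrite /S1 /S2; lra.
    by move=> x0; apply: (cell _ _ _ e3 _ x0); clear -hP1; lra.
  have h4 x : 0 <= x <= 2^-1 ->
      ((r ^+ 2 * d4 ^+ 2)%:E <= f (S1 (S2 (S2 x))))%E.
    have -> : S1 (S2 (S2 x)) = 4 / 27 + x / 27 by rewrite /S1 /S2; lra.
    by move=> x0; apply: (cell _ _ _ e4 _ x0); clear -hP1; lra.
  have h5 x : 0 <= x <= 2^-1 ->
      ((r ^+ 2 * d5 ^+ 2)%:E <= f (S2 (S1 (S1 x))))%E.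
    have -> : S2 (S1 (S1 x)) = 3^-1 + x / 27 by rewrite /S1 /S2; lra.
    by move=> x0; apply: (cell _ _ _ e5 _ x0); clear -hP1; lra.
  have h6 x : 0 <= x <= 2^-1 ->
      ((r ^+ 2 * d6 ^+ 2)%:E <= f (S2 (S1 (S2 x))))%E.
    have -> : S2 (S1 (S2 x)) = 10 / 27 + x / 27 by rewrite /S1 /S2; lra.
    by move=> x0; apply: (cell _ _ _ e6 _ x0); clear -hP1; lra.
  have h7 x : 0 <= x <= 2^-1 ->
      ((r ^+ 2 * d7 ^+ 2)%:E <= f (S2 (S2 (S1 x))))%E.
    have -> : S2 (S2 (S1 x)) = 4 / 9 + x / 27 by rewrite /S1 /S2; lra.
    by move=> x0; apply: (cell _ _ _ e7 _ x0); clear -hP1; lra.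
  have h8 x : 0 <= x <= 2^-1 ->
      ((r ^+ 2 * d8 ^+ 2)%:E <= f (S2 (S2 (S2 x))))%E.
    have -> : S2 (S2 (S2 x)) = 13 / 27 + x / 27 by rewrite /S1 /S2; lra.
    by move=> x0; apply: (cell _ _ _ e8 _ x0); clear -hP1; lra.
  have hm : (((r ^+ 2 * d1 ^+ 2 + r ^+ 2 * d2 ^+ 2) / 2 +
             (r ^+ 2 * d3 ^+ 2 + r ^+ 2 * d4 ^+ 2) / 2) / 2 +
            ((r ^+ 2 * d5 ^+ 2 + r ^+ 2 * d6 ^+ 2) / 2 +
             (r ^+ 2 * d7 ^+ 2 + r ^+ 2 * d8 ^+ 2) / 2) / 2) / 2 >=
      37 / 2000 * r ^+ 2.
    have := ler_wpM2l (sqr_ge0 r) dE; clear -hP1; lra.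
  apply: (le_trans (_ : (_ <= _%:E)%E)); first by rewrite lee_fin; exact: hm.
  have dd (d : R) : 0 <= r ^+ 2 * d ^+ 2 by rewrite mulr_ge0 ?sqr_ge0.
  by do 3! (apply: integral_cantor_ge_half => //); apply: (integral_cantor_ge hP1).
(* The cuts are the ends 1/6 and 1/3 of the central gap and its midpoint 1/4. The last two cases
   mirror the first two under [u -> 1/2 - u]. *)
have [u6|u6] := ltP u 6^-1.
  apply: (bound 0 0 0 0 (6^-1) (6^-1) (4^-1) (4^-1));
    first (by clear -hP1; lra);
    (split; first by clear -hP1; lra); clear -hP1 u6;
    [exact: Or31|exact: Or31|exact: Or31|exact: Or31|
     apply: Or32; lra|apply: Or32; lra|apply: Or32; lra|apply: Or32; lra].
have [u4|u4] := ltP u 4^-1.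
  (* This case and its mirror image are the tight ones and dictate [37 / 2000]: the squares sum to
     about 0.1485, against the required 0.148. Left distances are taken from 1/6, right ones from
     1/4. *)
  apply: (bound (4 / 27) (9^-1) (27^-1) 0 (12^-1) (13 / 108) (7 / 36) (25 / 108));
    first (by clear -hP1; lra);
    (split; first by clear -hP1; lra); clear -hP1 u6 u4;
    [apply: Or33; lra|apply: Or33; lra|apply: Or33; lra|exact: Or31|
     apply: Or32; lra|apply: Or32; lra|apply: Or32; lra|apply: Or32; lra].
have [u3|u3] := leP u 3^-1.
  apply: (bound (25 / 108) (7 / 36) (13 / 108) (12^-1) 0 (27^-1) (9^-1) (4 / 27));
    first (by clear -hP1; lra);
    (split; first by clear -hP1; lra); clear -hP1 u4 u3;
    [apply: Or33; lra|apply: Or33; lra|apply: Or33; lra|apply: Or33; lra|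
     exact: Or31|apply: Or32; lra|apply: Or32; lra|apply: Or32; lra].
apply: (bound (4^-1) (4^-1) (6^-1) (6^-1) 0 0 0 0);
    first (by clear -hP1; lra);
  (split; first by clear -hP1; lra); clear -hP1 u3;
  [apply: Or33; lra|apply: Or33; lra|apply: Or33; lra|apply: Or33; lra|
   exact: Or31|exact: Or31|exact: Or31|exact: Or31].
Qed.

(* The half-open interval makes the neighbourhoods of the two halves disjoint. *)
Definition near_cell t r (a : R) := (t - r / 4 <= a) && (a < t + 3 * r / 4).

(** Passing to the two halves divides [r ^+ 2] by 9 and the mass by 2, whence the factor 18, while
    the deficits [2 * 2 ^+ l - k] of the halves add up. A negative deficit makes the bound
    trivial. *)
Lemma cantor_lower (l : nat) alpha t r : 0 < r ->
  ((37 / 2000 * r ^+ 2 / 18 ^+ l *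
    (2 * 2 ^+ l - (count (near_cell t r) alpha)%:R))%:E <=
  \int[P1]_x sqdist_to alpha (t + r * x))%E.
Proof.
elim: l t r => [|l ih] t r r0.
  rewrite !expr0 divr1 mulr1.
  have far a : a \in alpha -> ~~ near_cell t r a ->
      a <= t - r / 4 \/ t + 3 * r / 4 <= a.
    move=> _; rewrite negb_and -ltNge -leNgt => /orP[/ltW|]; [by left|by right].
  case k: (count _ _) => [|[|k']].
  (* No near point: every distance is at least [r / 4], and 1/16 exceeds twice [37 / 2000]. *)
  - apply: (@le_trans _ _ ((16^-1 * r ^+ 2)%:E)).
      by rewrite lee_fin; have := sqr_ge0 r; lra.
    apply: (integral_cantor_ge hP1).
    + exact: measurable_sqdist_to_affine.
    + by move=> x; exact: sqdist_to_ge0.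
    + by rewrite mulr_ge0 ?sqr_ge0.
    + move=> x hx.
      have -> : 16^-1 * r ^+ 2 = r ^+ 2 * (4^-1) ^+ 2 by lra.
      (* A dummy near point, far enough from the cell to allow [d = 1/4]. *)
      apply: (@sqdist_to_affine_ge _ _ _ (-1)) => //; last by lra.
      * move=> a aa; have na : ~~ near_cell t r a.
          apply/negP => na; move: k; apply/eqP; rewrite -lt0n -has_count.
          by apply/hasP; exists a.
        by case: (far a aa na) => ?; [exact: Or32|exact: Or33].
      * by apply: Or32; lra.
  - have : size [seq a <- enum_fset alpha | near_cell t r a] = 1%N by rewrite size_filter.
    case e : [seq _ <- _ | _] => [|u [|? ?]] // _.
    have -> : 37 / 2000 * r ^+ 2 * (2 - 1%:R) = 37 / 2000 * r ^+ 2 by lra.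
    apply: (@cantor_one_near _ _ _ ((u - t) / r)) => // a aa.
    have [na|/(far _ aa)[?|?]] := boolP (near_cell t r a);
      [|exact: Or32|exact: Or33].
    apply: Or31; rewrite mulrCA divff ?gt_eqF// mulr1 subrKC.
    have : a \in [seq a <- enum_fset alpha | near_cell t r a].
      by rewrite mem_filter na.
    by rewrite e inE => /eqP.
  - apply: (@le_trans _ _ 0%E); last first.
      by apply: integral_ge0 => x _; exact: sqdist_to_ge0.
    rewrite lee_fin; apply: mulr_ge0_le0; first by have := sqr_ge0 r; lra.
    by rewrite subr_le0 (ler_nat R 2).
have := ih t (r / 3) (divr_gt0 r0 (ltr0Sn _ _)).
have := ih (t + r / 3) (r / 3) (divr_gt0 r0 (ltr0Sn _ _)).
set k1 := count _ _; set k2 := count _ _; set k := count _ _ => h2 h1.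
(* The neighbourhoods of the halves, [[t - r/12, t + r/4[] and [[t + r/4, t + 7r/12[], abut and lie
   within that of the whole cell. *)
have kk : k1%:R + k2%:R <= k%:R :> R.
  rewrite -natrD ler_nat /k1 /k2 -count_predUI.
  rewrite [X in (_ + X)%N](eq_count (a2 := pred0)) ?count_pred0 ?addn0; last first.
    by move=> a /=; apply/negP; rewrite /near_cell => /andP[/andP[? ?] /andP[? ?]]; lra.
  apply: sub_count => a /=; rewrite /near_cell => /orP[] /andP[? ?]; apply/andP; lra.
have e1 : (\int[P1]_x sqdist_to alpha (t + r / 3 * x) =
    \int[P1]_x sqdist_to alpha (t + r * S1 x))%E.
  by apply: eq_integral => x _; congr (sqdist_to alpha _); rewrite /S1; lra.
have e2 : (\int[P1]_x sqdist_to alpha (t + r / 3 + r / 3 * x) =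
    \int[P1]_x sqdist_to alpha (t + r * S2 x))%E.
  by apply: eq_integral => x _; congr (sqdist_to alpha _); rewrite /S2; lra.
rewrite e1 in h1; rewrite e2 in h2.
have := integral_cantor_ge_half (measurable_sqdist_to_affine alpha t r)
  (fun=> sqdist_to_ge0 _ _) h1 h2.
apply: le_trans; rewrite lee_fin !exprS invfM.
have : 0 <= r ^+ 2 / 18 ^+ l by rewrite divr_ge0 ?sqr_ge0 ?exprn_ge0.
move: kk; clear -hP1; move: (18 ^+ l)^-1 (2 ^+ l) => p q kk rp.
have := ler_wpM2l rp kk; lra.
Qed.

End cantor_quantization.

(** * Bounds for the quantization errors of [P1] and [P] *)

Section quantization_error.
Context {R : realType}.
Implicit Types (Q : probability (measurableTypeR R) R) (alpha : {fset R}).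

Lemma quantization_error_le Q n alpha (b : \bar R) :
  (1 <= #|` alpha| <= n)%N -> (\int[Q]_x sqdist_to alpha x <= b)%E ->
  (quantization_error Q n <= b)%E.
Proof. by move=> ha; apply: le_trans; apply: ereal_inf_lbound; exists alpha. Qed.

Lemma quantization_error_ge Q n (b : \bar R) :
  (forall alpha, (1 <= #|` alpha| <= n)%N -> (b <= \int[Q]_x sqdist_to alpha x)%E) ->
  (b <= quantization_error Q n)%E.
Proof. by move=> h; apply: le_ereal_inf_tmp => _ [alpha ha <-]; exact: h. Qed.

Lemma quantization_error_anti Q m n : (m <= n)%N ->
  (quantization_error Q n <= quantization_error Q m)%E.
Proof.
move=> mn; apply: quantization_error_ge => alpha /andP[a0 am].
by apply: (@quantization_error_le _ _ alpha); rewrite ?a0 ?(leq_trans am).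
Qed.

Lemma quantization_error_ge0 Q n : (0 <= quantization_error Q n)%E.
Proof.
apply: quantization_error_ge => alpha _.
by apply: integral_ge0 => x _; exact: sqdist_to_ge0.
Qed.

Lemma fin_num_quantization_error Q n (b : R) :
  (quantization_error Q n <= b%:E)%E -> quantization_error Q n \is a fin_num.
Proof.
move=> h; rewrite ge0_fin_numE ?quantization_error_ge0//.
exact: le_lt_trans h (ltry _).
Qed.

Lemma Vn_le Q n (b : R) : (quantization_error Q n <= b%:E)%E -> Vn Q n <= b.
Proof.
by move=> h; rewrite -lee_fin fineK// (fin_num_quantization_error h).
Qed.

(** As [fine] sends +oo to 0, a lower bound passes to [Vn] only once the error is known to be
    finite; [b'] certifies this. *)
Lemma Vn_ge Q n (b b' : R) : (quantization_error Q n <= b'%:E)%E ->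
  (b%:E <= quantization_error Q n)%E -> b <= Vn Q n.
Proof.
by move=> h ?; rewrite -lee_fin fineK// (fin_num_quantization_error h).
Qed.

Variable (P1 : probability (measurableTypeR R) R).
Hypothesis hP1 : cantor_distribution P1.

Lemma cantor_quantization_le n l : (2 ^ l <= n)%N ->
  (quantization_error P1 n <= ((9 ^+ l)^-1 / 32)%:E)%E.
Proof.
move=> ln; apply: (le_trans (quantization_error_anti P1 ln)).
by have [alpha ha] := cantor_codebook hP1 l; exact: quantization_error_le.
Qed.

Lemma cantor_integral_sqdist_ge alpha n l : (#|` alpha| <= n)%N ->
  ((37 / 2000 / 18 ^+ l * (2 * 2 ^+ l - n%:R))%:E <=
   \int[P1]_x sqdist_to alpha x)%E.
Proof.
move=> an; have := cantor_lower hP1 l alpha 0 (ltr01 : 0 < 1 :> R).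
rewrite (_ : (\int[P1]_x sqdist_to alpha (0 + 1 * x) =
              \int[P1]_x sqdist_to alpha x)%E); last first.
  by apply: eq_integral => x _; rewrite add0r mul1r.
apply: le_trans; rewrite lee_fin expr1n mulr1.
apply: ler_wpM2l; first by rewrite divr_ge0 ?exprn_ge0 ?divr_ge0 ?ler0n.
by rewrite lerB// ler_nat (leq_trans (count_size _ _)).
Qed.

Let P : probability (measurableTypeR R) R := half_mixture P1 uniformD.

Let integral_P alpha : (\int[P]_x sqdist_to alpha x =
  2^-1%:E * (\int[P1]_x sqdist_to alpha x + \int[uniformD]_x sqdist_to alpha x))%E.
Proof.
apply: integral_half_mixture; first exact: measurable_sqdist_to.
by move=> x; exact: sqdist_to_ge0.
Qed.

(** Adding the three atoms to a codebook for [P1] kills the discrete half and does not increase the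
    other. *)
Lemma mixture_quantization_le n l : (2 ^ l + 3 <= n)%N ->
  (quantization_error P n <= ((9 ^+ l)^-1 / 64)%:E)%E.
Proof.
move=> ln; have [alpha /andP[a0 al] ha] := cantor_codebook hP1 l.
pose D : {fset R} := [fset 2 / 3; 5 / 6; 1]%fset.
have D3 : (#|` D| <= 3)%N.
  by rewrite /D !cardfsU !cardfs1; lia.
have sub : {subset alpha <= (alpha `|` D)%fset} by move=> a aa; rewrite inE aa.
have zero d : d \in D -> sqdist_to (alpha `|` D)%fset d = 0%E.
  move=> dD; apply/eqP; rewrite eq_le sqdist_to_ge0 andbT.
  have dAD : d \in (alpha `|` D)%fset by rewrite in_fsetU dD orbT.
  by apply: (le_trans (sqdist_to_le d dAD)); rewrite subrr expr0n.
apply: (@quantization_error_le _ _ (alpha `|` D)%fset).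
  apply/andP; split.
    by rewrite (leq_trans a0)// fsubset_leq_card// fsubsetUl.
  rewrite cardfsU (leq_trans (leq_subr _ _))// (leq_trans _ ln)//.
  by rewrite leq_add.
rewrite integral_P integral_uniformD_eq0; last 5 first.
- exact: measurable_sqdist_to.
- by move=> x; exact: sqdist_to_ge0.
- by apply: zero; rewrite !inE eqxx.
- by apply: zero; rewrite !inE eqxx orbT.
- by apply: zero; rewrite !inE eqxx !orbT.
rewrite adde0.
have -> : (9 ^+ l)^-1 / 64 = 2^-1 * ((9 ^+ l)^-1 / 32) :> R by lra.
rewrite EFinM; apply: lee_wpmul2l => //; apply: le_trans ha.
apply: ge0_le_integral => //.
- by move=> x _; exact: sqdist_to_ge0.
- exact: measurable_sqdist_to.
- exact: measurable_sqdist_to.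
- by move=> x _; exact: sqdist_to_subset.
Qed.

Lemma mixture_quantization_ge n l :
  ((37 / 4000 / 18 ^+ l * (2 * 2 ^+ l - n%:R))%:E <= quantization_error P n)%E.
Proof.
apply: quantization_error_ge => alpha /andP[_ an].
rewrite integral_P; have := cantor_integral_sqdist_ge l an.
set x := 2 * _ - _ => h.
have -> : 37 / 4000 / 18 ^+ l * x = 2^-1 * (37 / 2000 / 18 ^+ l * x) by lra.
rewrite EFinM; apply: lee_wpmul2l => //.
apply: (le_trans h); rewrite leeDl//.
by apply: integral_ge0 => y _; exact: sqdist_to_ge0.
Qed.

Lemma Vn_cantor_le n l : (2 ^ l <= n)%N -> Vn P1 n <= 32^-1 / 9 ^+ l.
Proof. by move=> h; apply: Vn_le; rewrite mulrC; exact: cantor_quantization_le. Qed.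

Lemma Vn_cantor_ge n l : (0 < n)%N ->
  37 / 2000 / 18 ^+ l * (2 * 2 ^+ l - n%:R) <= Vn P1 n.
Proof.
move=> n0; apply: (Vn_ge (@cantor_quantization_le n 0 n0)).
by apply: quantization_error_ge => alpha /andP[_]; exact: cantor_integral_sqdist_ge.
Qed.

Lemma Vn_mixture_le n l : (2 ^ l + 3 <= n)%N -> Vn P n <= 64^-1 / 9 ^+ l.
Proof. by move=> h; apply: Vn_le; rewrite mulrC; exact: mixture_quantization_le. Qed.

Lemma Vn_mixture_ge n l : (3 < n)%N ->
  37 / 4000 / 18 ^+ l * (2 * 2 ^+ l - n%:R) <= Vn P n.
Proof.
move=> n0; apply: (Vn_ge (@mixture_quantization_le n 0 n0)).
exact: mixture_quantization_ge.
Qed.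

End quantization_error.

(** * The dimension limit, a criterion for oscillation, and the exponent [2 / beta] *)

Section asymptotics.
Context {R : realType}.

(** For [2 ^ (l + 1) <= n < 2 ^ (l + 2)], the upper bound at level [l] and the lower one at level
    [l + 2] place [V n] between [c / 9 ^+ l.+2] and [C / 9 ^+ l], so [- ln (V n)] and
    [2 * (ln 3 / ln 2) * ln n] differ by a bounded amount. *)
Lemma cvg_dimension (V : R^nat) (c C : R) : 0 < c -> 0 < C ->
  (forall n l, (2 ^ l + 3 <= n)%N -> V n <= C / 9 ^+ l) ->
  (forall n l, (3 < n)%N -> c / 18 ^+ l * (2 * 2 ^+ l - n%:R) <= V n) ->
  (fun n => 2 * ln n%:R / - ln (V n)) @ \oo --> ln 2 / ln 3.
Proof.
move=> c0 C0 hC hc.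
have a0 : 0 < ln 2 :> R by rewrite ln_gt0// ltr1n.
have b0 : 0 < ln 3 :> R by rewrite ln_gt0// ltr1n.
(* The reciprocal has the explicit denominator [2 * ln n], which turns a bounded error into a
   vanishing one. *)
suff : (fun n => - ln (V n) / (2 * ln n%:R)) @ \oo --> ln 3 / ln 2.
  move=> /(cvgV (lt0r_neq0 (divr_gt0 b0 a0))); rewrite invf_div; apply: cvg_trans.
  by apply: near_eq_cvg; near=> n; rewrite /= invf_div.
apply/cvgrPdist_le => e e0.
(* [K] bounds that error; [4 * ln 3] pays for the gap of two levels. *)
pose K : R := 4 * ln 3 + `|ln C| + `|ln c|.
near=> n.
have n8 : (8 <= n)%N by near: n; exact: nbhs_infty_ge.
have n0 : (0 < n)%N by apply: leq_trans n8.
have hn : expR (K / (2 * e)) <= n%:R by near: n; exact: nbhs_infty_ger.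
have /andP[le_n nl] := trunc_log_bounds (isT : (1 < 2)%N) n0.
(* The logarithm is renamed [l + 1] with [l >= 2], so that [2 ^ l + 3 <= 2 ^ (l + 1)]. *)
have : (2 < trunc_log 2 n)%N by apply: trunc_log_max.
move: le_n nl; case: (trunc_log 2 n) => // l le_n nl l2.
have nR : 0 < n%:R :> R by rewrite ltr0n.
have x1 : l.+1%:R * ln 2 <= ln n%:R :> R.
  rewrite mulr_natl -lnXn// ler_ln ?posrE ?exprn_gt0//.
  by rewrite -natrX ler_nat.
have x2 : ln n%:R <= l.+2%:R * ln 2 :> R.
  rewrite mulr_natl -lnXn// ler_ln ?posrE ?exprn_gt0//.
  by rewrite -natrX ler_nat ltnW.
have V1 : V n <= C / 9 ^+ l.
  apply: hC; rewrite (leq_trans _ le_n)// expnS mul2n -addnn leq_add2l.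
  by rewrite (leq_trans _ (leq_pexp2l (isT : 0 < 2)%N (l2 : 2 <= l)%N)).
have V2 : c / 9 ^+ l.+2 <= V n.
  apply: (le_trans _ (hc n l.+2 _)); last by rewrite (leq_trans _ n8).
  rewrite -mulrA ler_pM2l//.
  have -> : (9 ^+ l.+2)^-1 = (18 ^+ l.+2)^-1 * 2 ^+ l.+2 :> R.
    have -> : 18 = 2 * 9 :> R by lra.
    by rewrite exprMn; field; rewrite !expf_neq0.
  rewrite ler_pM2l ?invr_gt0 ?exprn_gt0//.
  have : n%:R <= 2 ^+ l.+2 :> R by rewrite -natrX ler_nat ltnW.
  by lra.
have V0 : 0 < V n by apply: lt_le_trans V2; rewrite divr_gt0 ?exprn_gt0.
have ln9 k : ln (9 ^+ k) = 2 * k%:R * ln 3 :> R.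
  have -> : 9 = 3 ^+ 2 :> R by lra.
  by rewrite -exprM lnXn// -[LHS]mulr_natl natrM.
have v1 : ln (V n) <= ln C - 2 * l%:R * ln 3.
  rewrite -ln9 -ln_div ?posrE ?exprn_gt0//.
  by rewrite ler_ln ?posrE ?divr_gt0 ?exprn_gt0.
have v2 : ln c - 2 * l.+2%:R * ln 3 <= ln (V n).
  rewrite -ln9 -ln_div ?posrE ?exprn_gt0//.
  by rewrite ler_ln ?posrE ?divr_gt0 ?exprn_gt0.
have Kx : K <= e * (2 * ln n%:R).
  have : K / (2 * e) <= ln n%:R by rewrite -(expRK (K / (2 * e))) ler_ln ?posrE ?expR_gt0.
  by rewrite ler_pdivrMr ?mulr_gt0//; lra.
have x0 : 0 < ln n%:R :> R by rewrite ln_gt0// ltr1n (leq_trans _ n8).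
have -> : ln 3 / ln 2 - - ln (V n) / (2 * ln n%:R) =
    (2 * (ln 3 / ln 2 * ln n%:R) + ln (V n)) / (2 * ln n%:R).
  by field; rewrite !gt_eqF.
rewrite normrM normfV (@gtr0_norm _ (2 * _)) ?mulr_gt0// ler_pdivrMr ?mulr_gt0//.
apply: le_trans Kx.
have y1 : l.+1%:R * ln 3 <= ln 3 / ln 2 * ln n%:R :> R.
  have -> : ln 3 / ln 2 * ln n%:R = ln n%:R * ln 3 / ln 2 :> R by lra.
  rewrite ler_pdivlMr// -subr_ge0.
  by have := ler_wpM2r (ltW b0) x1; lra.
have y2 : ln 3 / ln 2 * ln n%:R <= l.+2%:R * ln 3 :> R.
  have -> : ln 3 / ln 2 * ln n%:R = ln n%:R * ln 3 / ln 2 :> R by lra.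
  rewrite ler_pdivrMr// -subr_ge0.
  by have := ler_wpM2r (ltW b0) x2; lra.
have := ler_norm (ln C); have := ler_norm (ln c).
have := ler_norm (- ln C); have := ler_norm (- ln c); rewrite !normrN.
move: y1 y2 v1 v2; rewrite -[l.+2]addn2 -[l.+1]addn1 !natrD.
move: (_ / _ * _) => y; rewrite ler_norml /K => *; apply/andP; split; lra.
Unshelve. all: by end_near.
Qed.

Lemma limn_einf_neq_esup (u : R^nat) (A B : R) : A < B ->
  (forall N, exists2 n, (N <= n)%N & u n <= A) ->
  (forall N, exists2 n, (N <= n)%N & B <= u n) ->
  limn_einf (EFin \o u) <> limn_esup (EFin \o u).
Proof.
move=> AB hA hB e.
have h1 : (limn_einf (EFin \o u) <= A%:E)%E.
  rewrite limn_einf_lim; apply: lime_le; first exact: is_cvg_einfs.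
  apply: nearW => N; have [n Nn un] := hA N.
  by apply: (@le_trans _ _ (u n)%:E); [apply: ereal_inf_lbound; exists n|].
have h2 : (B%:E <= limn_esup (EFin \o u))%E.
  rewrite limn_esup_lim; apply: lime_ge; first exact: is_cvg_esups.
  apply: nearW => N; have [n Nn un] := hB N.
  by apply: (@le_trans _ _ (u n)%:E); [|apply: ereal_sup_ubound; exists n].
by move: h2; rewrite -e => /le_trans/(_ h1); rewrite lee_fin leNgt AB.
Qed.

(** Doubling [n] multiplies [n ^ (2 / beta)] by exactly the 9 that one level costs in [V_n]. *)
Lemma two_powR_gamma l : (2 ^+ l) `^ (2 / (ln 2 / ln 3)) = 9 ^+ l :> R.
Proof.
have a0 : 0 < ln 2 :> R by rewrite ln_gt0// ltr1n.
have b0 : 0 < ln 3 :> R by rewrite ln_gt0// ltr1n.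
apply: ln_inj; rewrite ?posrE ?powR_gt0 ?exprn_gt0// ln_powR !lnXn//.
have -> : 9 = 3 ^+ 2 :> R by lra.
by rewrite lnXn//; field; rewrite !gt_eqF.
Qed.

(** A crude bound, which only has to control a factor close to 1. *)
Lemma gamma_le4 : 2 / (ln 2 / ln 3) <= 4 :> R.
Proof.
have a0 : 0 < ln 2 :> R by rewrite ln_gt0// ltr1n.
have b0 : 0 < ln 3 :> R by rewrite ln_gt0// ltr1n.
rewrite invf_div mulrA ler_pdivrMr//.
have : ln 3 <= ln (2 ^+ 2) :> R by rewrite ler_ln ?posrE; lra.
by rewrite lnXn//; lra.
Qed.

(* [3 ^ (2 log 3 / log 2)] is bounded below through [2 ^ 11 <= 3 ^ 7] and
   [7 ^ 7 <= 2 ^ 7 * 3 ^ 8]. *)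
Lemma three_powR_gamma : 63 / 2 <= 3 `^ (2 / (ln 2 / ln 3)) :> R.
Proof.
have a0 : 0 < ln 2 :> R by rewrite ln_gt0// ltr1n.
have b0 : 0 < ln 3 :> R by rewrite ln_gt0// ltr1n.
have g : 22 / 7 <= 2 / (ln 2 / ln 3) :> R.
  rewrite invf_div mulrA ler_pdivlMr//.
  have : ln (2 ^+ 11) <= ln (3 ^+ 7) :> R.
    by rewrite ler_ln ?posrE ?exprn_gt0// -!natrX ler_nat.
  by rewrite !lnXn//; lra.
apply: (le_trans _ (ler_powR (ler1n R 3) g)).
rewrite -ler_ln ?posrE ?powR_gt0// ?divr_gt0// ln_powR.
have : ln (7 ^+ 7) <= ln (2 ^+ 7 * 3 ^+ 8) :> R.
  by rewrite ler_ln ?posrE ?mulr_gt0 ?exprn_gt0//; lra.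
have -> : ln (63 / 2) = ln 3 *+ 2 + ln 7 - ln 2 :> R.
  have -> : 63 / 2 = 3 ^+ 2 * 7 / 2 :> R by lra.
  by rewrite ln_div ?posrE ?mulr_gt0 ?exprn_gt0// lnM ?posrE ?exprn_gt0// lnXn.
by rewrite lnM ?posrE ?exprn_gt0// !lnXn//; lra.
Qed.

End asymptotics.

(** * Dimensions of both measures, and two subsequences of the coefficient sequence of [P] *)

Section mixture.
Context {R : realType} (P1 : probability (measurableTypeR R) R).
Hypothesis hP1 : cantor_distribution P1.

Let P : probability (measurableTypeR R) R := half_mixture P1 uniformD.
Let beta : R := ln 2 / ln 3.

Lemma cvg_dimension_cantor : dimension_seq P1 @ \oo --> beta.
Proof.
apply: (@cvg_dimension _ _ (37 / 2000) 32^-1).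
- lra.
- lra.
- by move=> n l h; apply: Vn_cantor_le => //; apply: leq_trans h; exact: leq_addr.
- by move=> n l h; apply: Vn_cantor_ge => //; apply: leq_trans h.
Qed.

Lemma cvg_dimension_mixture : dimension_seq P @ \oo --> beta.
Proof.
apply: (@cvg_dimension _ _ (37 / 4000) 64^-1).
- lra.
- lra.
- by move=> n l; exact: Vn_mixture_le.
- by move=> n l; exact: Vn_mixture_ge.
Qed.

(** Along [n = 2 ^ l + 3] the upper bound tends to [1/64 = 50/3200]; [51 / 3200] leaves room for the
    three extra points. *)
Lemma coefficient_seq_small N :
  exists2 n, (N <= n)%N & coefficient_seq beta P n <= 51 / 3200.
Proof.
pose l := (N + 10)%N; exists (2 ^ l + 3)%N.
  by rewrite (leq_trans _ (leq_addr _ _))// (leq_trans _ (ltnW (ltn_expl l _)))// leq_addr.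
rewrite /coefficient_seq; set g := 2 / beta.
have g0 : 0 <= g.
  by rewrite /g /beta !divr_ge0 ?ln_ge0 ?ler1n.
(* Since [3 / 900 = 1 / 300], this gives [2 ^ l + 3 <= 2 ^ l * (301 / 300)]. *)
have l900 : 900%:R <= 2 ^+ l :> R.
  rewrite -natrX ler_nat (@leq_trans (2 ^ 10)%N)// leq_exp2l//.
  exact: leq_addl.
have h : (2 ^ l + 3)%:R `^ g <= 9 ^+ l * (301 / 300) ^+ 4 :> R.
  apply: (@le_trans _ _ ((2 ^+ l * (301 / 300)) `^ g)).
    apply: ge0_ler_powR; first exact: g0.
    - by rewrite nnegrE ler0n.
    - by rewrite nnegrE; apply: mulr_ge0; [rewrite exprn_ge0|lra].
    - by rewrite natrD natrX; lra.
  rewrite powRM; [|by rewrite exprn_ge0|lra].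
  rewrite two_powR_gamma ler_pM2l; last by rewrite exprn_gt0.
  rewrite -powR_mulrn; last by lra.
  by apply: ler_powR; [lra|exact: gamma_le4].
apply: (@le_trans _ _ (9 ^+ l * (301 / 300) ^+ 4 * (64^-1 / 9 ^+ l))).
  apply: ler_pM.
  - exact: powR_ge0.
  - by apply: fine_ge0; exact: quantization_error_ge0.
  - exact: h.
  - exact: Vn_mixture_le.
have -> : 9 ^+ l * (301 / 300) ^+ 4 * (64^-1 / 9 ^+ l) = (301 / 300) ^+ 4 / 64 :> R.
  by field; rewrite expf_neq0.
lra.
Qed.

(** For [n = x * 2 ^ l], level [l + 1] yields a multiple of [(4 - x) * x ^ (2 / beta)], whose
    maximiser is close to 3. The resulting bound, about 0.01619, exceeds [51 / 3200], about
    0.01594. *)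
Lemma coefficient_seq_large N :
  exists2 n, (N <= n)%N & 259 / 160 / 100 <= coefficient_seq beta P n.
Proof.
pose l := (N + 1)%N; exists (3 * 2 ^ l)%N.
  by rewrite (leq_trans _ (leq_pmull _ _))// (leq_trans _ (ltnW (ltn_expl l _)))// leq_addr.
rewrite /coefficient_seq; set g := 2 / beta.
have n3 : (3 < 3 * 2 ^ l)%N.
  by have : (2 ^ 1 <= 2 ^ l)%N; [rewrite leq_exp2l// leq_addl|lia].
have nE : (3 * 2 ^ l)%:R = 3 * 2 ^+ l :> R by rewrite natrM natrX.
have e18 : 18 ^+ l = 2 ^+ l * 9 ^+ l :> R by rewrite -exprMn; congr (_ ^+ _); lra.
(* At level [l + 1] the deficit [2 * 2 ^ (l + 1) - 3 * 2 ^ l] equals [2 ^ l]. *)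
have hV : 37 / 72 / 1000 / 9 ^+ l <= Vn P (3 * 2 ^ l)%N.
  apply: le_trans (Vn_mixture_ge hP1 l.+1 n3).
  rewrite nE !exprS e18 le_eqVlt; apply/orP; left; apply/eqP.
  by field; rewrite !expf_neq0.
rewrite nE powRM; [|lra|by rewrite exprn_ge0].
rewrite two_powR_gamma.
apply: (@le_trans _ _ (63 / 2 * 9 ^+ l * (37 / 72 / 1000 / 9 ^+ l))).
  by rewrite le_eqVlt; apply/orP; left; apply/eqP; field; rewrite expf_neq0.
apply: ler_pM.
- by apply: mulr_ge0; [lra|rewrite exprn_ge0].
- by apply: divr_ge0; [lra|rewrite exprn_ge0].
- by rewrite ler_pM2r ?exprn_gt0//; exact: three_powR_gamma.
- exact: hV.
Qed.

End mixture.

Unset Implicit Arguments.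

Theorem mainTheorem7 (R : realType)
    (P1 : probability (measurableTypeR R) R) (hP1 : cantor_distribution P1) :
  let P2 : probability (measurableTypeR R) R := uniformD in
  let P : probability (measurableTypeR R) R := half_mixture P1 P2 in
  let beta : R := ln 2 / ln 3 in
  [/\ has_quantization_dimension P,
      has_quantization_dimension P1,
      quantization_dimension P = quantization_dimension P1,
      quantization_dimension P1 = beta &
      ~ has_quantization_coefficient P /\ ~ cvgn (coefficient_seq beta P)].
Proof.
move=> P2 P beta.
have cP := cvg_dimension_mixture hP1; have cP1 := cvg_dimension_cantor hP1.
have dP : quantization_dimension P = beta by exact: cvg_lim cP.
have dP1 : quantization_dimension P1 = beta by exact: cvg_lim cP1.
(* This single oscillation refutes both the coefficient and convergence, as a limit would equal both
   the lower and the upper limit. *)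
have osc : limn_einf (EFin \o coefficient_seq beta P) <>
    limn_esup (EFin \o coefficient_seq beta P).
  apply: (@limn_einf_neq_esup _ _ (51 / 3200) (259 / 160 / 100)); first lra.
  - exact: coefficient_seq_small.
  - exact: coefficient_seq_large.
split; [by apply/cvg_ex; exists beta|by apply/cvg_ex; exists beta|
  by rewrite dP dP1|by []|split].
- by rewrite /has_quantization_coefficient /= dP.
- move=> /cvg_ex[l cl]; apply: osc.
  have cE : EFin \o coefficient_seq beta P @ \oo --> l%:E.
    by apply: cvg_EFin => //; exact: nearW.
  by rewrite !(cvg_limn_einf_sup cE).
Qed.
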